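(* Let $f=H+|z|^2G$ be a biharmonic mapping of $\mathbb{D}$, with $H$ and $G$ harmonic in $\mathbb{D}$, such that $B_f<\infty$. Then $$B_f\ge\sup_{z\in\mathbb{D}}(1-|z|^2)\Big|\,\big|H_z+|z|^2G_z\big|-\big|H_{\overline z}+|z|^2G_{\overline z}\big|\,\Big|$$ and, where $M$ is a positive constant such that $|H(z)|\le M$ and $|G(z)|\le M$ for all $z\in\mathbb{D}$, $$B_f\le\frac{4M}{27\pi^3}\left(8+36\pi^2+\left(4+3\pi^2\right)^{3/2}\right)\approx 30.7682\,M.$$
   Context: $\mathbb{D}=\{z\in\mathbb{C}:|z|<1\}$. Harmonic means complex-valued with $\Delta u=0$, and biharmonic means four times continuously differentiable, complex-valued, with $\Delta(\Delta f)=0$, where $\Delta=4\frac{\partial^2}{\partial z\partial\overline z}$. The quantity $B_f$ is $$B_f=\sup_{z,w\in\mathbb{D},\,z\ne w}\frac{|f(z)-f(w)|}{\rho(z,w)},\qquad \rho(z,w)=\frac12\log\left(\frac{1+\left|\frac{z-w}{1-\overline zw}\right|}{1-\left|\frac{z-w}{1-\overline zw}\right|}\right).$$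
   Formalization: The numerical value ''≈ 30.7682 M'' is omitted because it is wrong: the closed-form constant (4M/(27π³))(8+36π²+(4+3π²)^{3/2}) is about 2.667 M; the theorem states the upper bound with the exact closed form only. *)

(* Defs.v *)
From Stdlib Require Import Reals.
From Coquelicot Require Import Coquelicot.

Open Scope R_scope.

Definition unit_disc (z : C) : Prop := Cmod z < 1.

(* Mappings of the disc are total functions [C -> C]; only their values on the
   disc matter. *)

(* [ex_diff_n g n x y] gives existence and continuity at [(x, y)] of all
   iterated partial derivatives of [g] of order at most [n]; required at every
   point of the (open) disc, this is the class C^n. *)
Definition Cn_on_disc (n : nat) (f : C -> C) : Prop :=
  forall z : C, unit_disc z ->
    ex_diff_n (fun x y => Re (f (x, y))) n (Re z) (Im z) /\
    ex_diff_n (fun x y => Im (f (x, y))) n (Re z) (Im z).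

Definition d_x (f : C -> C) (z : C) : C :=
  (Derive (fun x => Re (f (x, Im z))) (Re z),
   Derive (fun x => Im (f (x, Im z))) (Re z)).

Definition d_y (f : C -> C) (z : C) : C :=
  (Derive (fun y => Re (f (Re z, y))) (Im z),
   Derive (fun y => Im (f (Re z, y))) (Im z)).

Definition d_z (f : C -> C) (z : C) : C :=
  ((d_x f z - Ci * d_y f z) / 2)%C.

Definition d_zbar (f : C -> C) (z : C) : C :=
  ((d_x f z + Ci * d_y f z) / 2)%C.

Definition laplacian (f : C -> C) (z : C) : C :=
  (4 * d_z (d_zbar f) z)%C.

Definition harmonic (u : C -> C) : Prop :=
  Cn_on_disc 2 u /\
  forall z : C, unit_disc z -> laplacian u z = 0%C.

Definition biharmonic (f : C -> C) : Prop :=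
  Cn_on_disc 4 f /\
  forall z : C, unit_disc z -> laplacian (laplacian f) z = 0%C.

Definition rho (z w : C) : R :=
  let t := Cmod ((z - w) / (1 - Cconj z * w))%C in
  / 2 * ln ((1 + t) / (1 - t)).

(* Valued in the extended reals: [p_infty] when the quotients are unbounded. *)
Definition B (f : C -> C) : Rbar :=
  Lub_Rbar (fun t : R => exists z w : C,
    unit_disc z /\ unit_disc w /\ z <> w /\ t = Cmod (f z - f w)%C / rho z w).

(* Main.v *)
(** Everything reduces to real functions [Re (c * u)] with [|c| = 1], and to the
    automorphisms [phi(z) = (e z + a) / (1 + conj(a) e z)] of the disc, [|e| = 1]. The path
    [t |-> phi(t)] is a hyperbolic geodesic from [a], with [rho (phi(t)) a = artanh t].

    Lower bound: differentiating along this path at [t = 0] bounds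
    [(1 - |a|^2) |D_e f(a)|] by [B f]. For [e] orthogonal to [a] the derivative of [|z|^2]
    vanishes, so [D_e f] becomes [A e + A' conj(e)] with [A = H_z + |a|^2 G_z] and
    [A' = H_zbar + |a|^2 G_zbar].

    Upper bound: a real harmonic [w] with [|w| <= M] satisfies
    [(1 - |a|^2) |grad w (a)| <= 4 M / PI]. Composing with [phi] reduces this to [a = 0],
    where [F(r)], the integral of [w(r e^(it)) cos t] over a period, solves
    [r^2 F'' + r F' - F = 0], hence [F(r) = PI w_x(0) r], while [|F| <= 4 M]. This gives
    [(1 - r^2) |grad| <= (4 M / PI) (1 + r^2) + 2 M r (1 - r^2)] at [|z| = r] for the
    components of [f]; the stated constant is the maximum of the right-hand side, and
    integrating along [phi] bounds [B f]. *)

Require Import Defs.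
From Stdlib Require Import Reals Lra Psatz FunctionalExtensionality.
From Coquelicot Require Import Coquelicot.

Open Scope R_scope.

(** * Differential calculus for real and complex functions of a complex variable *)

Ltac C_ring :=
  unfold Re, Im, RtoC, Ci, Cminus, Cplus, Copp, Cmult, Cconj in *; simpl in *;
  first [ ring | f_equal; ring ].

(* The gradient of a real function is encoded as the complex number [w_x + i w_y]. *)
Definition has_grad (w : C -> R) (z g : C) : Prop :=
  differentiable_pt_lim (fun x y => w (x, y)) (Re z) (Im z) (Re g) (Im g).

Definition continuous_at (w : C -> R) (z : C) : Prop :=
  continuity_2d_pt (fun x y => w (x, y)) (Re z) (Im z).

(* Differentiability with the Cauchy-Riemann equations. *)
Definition has_cderiv (F : C -> C) (z d : C) : Prop :=
  has_grad (fun u => Re (F u)) z (Re d, - Im d) /\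
  has_grad (fun u => Im (F u)) z (Im d, Re d).

Lemma has_grad_ext_loc (f g : C -> R) (z d : C) :
  locally_2d (fun x y => f (x, y) = g (x, y)) (Re z) (Im z) ->
  has_grad f z d -> has_grad g z d.
Proof. exact (differentiable_pt_lim_ext _ _ _ _ _ _). Qed.

Lemma has_grad_ext (f g : C -> R) (z d : C) :
  (forall u, f u = g u) -> has_grad f z d -> has_grad g z d.
Proof.
  intros H; apply has_grad_ext_loc, locally_2d_forall; intros; apply H.
Qed.

Lemma has_grad_eq (f : C -> R) (z d d' : C) :
  has_grad f z d -> d = d' -> has_grad f z d'.
Proof. now intros H <-. Qed.

Lemma has_grad_of_filterdiff (f : C -> R) (L : R * R -> R) (z g : C) :
  filterdiff (fun u : R * R => f u) (locally (z : R * R)) L ->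
  (forall x y : R, L (x, y) = x * Re g + y * Im g) ->
  has_grad f z g.
Proof.
  intros H HL; apply filterdiff_differentiable_pt_lim.
  destruct z as [x y]; simpl.
  eapply filterdiff_ext_lin; [ eapply filterdiff_ext; [ | exact H ] | ].
  - now intros [u v].
  - intros [u v]; apply HL.
Qed.

Lemma has_grad_const (c : R) (z : C) : has_grad (fun _ => c) z 0.
Proof.
  eapply has_grad_of_filterdiff; [ apply filterdiff_const | ].
  intros x y; change (0 = x * 0 + y * 0); ring.
Qed.

Lemma has_grad_Re (z : C) : has_grad Re z (1, 0).
Proof.
  eapply has_grad_of_filterdiff; [ apply filterdiff_linear, is_linear_fst | ].
  intros x y; simpl; ring.
Qed.

Lemma has_grad_Im (z : C) : has_grad Im z (0, 1).
Proof.
  eapply has_grad_of_filterdiff; [ apply filterdiff_linear, is_linear_snd | ].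
  intros x y; simpl; ring.
Qed.

(** The two-variable chain rule. The sum, product and inverse rules follow by taking for [w] the
    corresponding operation on the coordinates of a pair. *)
Lemma has_grad_comp_pair (w f g : C -> R) (z dw df dg : C) :
  has_grad w (f z, g z) dw -> has_grad f z df -> has_grad g z dg ->
  has_grad (fun u => w (f u, g u)) z
    (Re dw * Re df + Im dw * Re dg, Re dw * Im df + Im dw * Im dg).
Proof.
  unfold has_grad; simpl; intros Hw Hf Hg.
  apply (differentiable_pt_lim_comp (fun x y => w (x, y))
           (fun x y => f (x, y)) (fun x y => g (x, y))); auto.
  now destruct z.
Qed.

Lemma has_grad_plus (f g : C -> R) (z df dg : C) :
  has_grad f z df -> has_grad g z dg ->
  has_grad (fun u => f u + g u) z (df + dg)%C.
Proof.
  intros Hf Hg.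
  eapply has_grad_eq.
  - apply (has_grad_comp_pair (fun u => Re u + Im u) f g z (1, 1)); eauto.
    eapply has_grad_of_filterdiff.
    + apply (filterdiff_plus_fct (fun u : R * R => fst u) (fun u : R * R => snd u));
        apply filterdiff_linear; [ apply is_linear_fst | apply is_linear_snd ].
    + intros x y; unfold plus; simpl; ring.
  - destruct df, dg; C_ring.
Qed.

Lemma has_grad_mult (f g : C -> R) (z df dg : C) :
  has_grad f z df -> has_grad g z dg ->
  has_grad (fun u => f u * g u) z (RtoC (f z) * dg + RtoC (g z) * df)%C.
Proof.
  intros Hf Hg.
  eapply has_grad_eq.
  - apply (has_grad_comp_pair (fun u => Re u * Im u) f g z (g z, f z)); eauto.
    eapply has_grad_of_filterdiff.
    + apply (filterdiff_mult_fct (fun u : R * R => fst u) (fun u : R * R => snd u));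
        [ intros; apply Rmult_comm | |];
        apply filterdiff_linear; [ apply is_linear_fst | apply is_linear_snd ].
    + intros x y; unfold plus, mult; simpl; ring.
  - destruct df, dg; C_ring.
Qed.

Lemma has_grad_scal (c : R) (f : C -> R) (z df : C) :
  has_grad f z df -> has_grad (fun u => c * f u) z (RtoC c * df)%C.
Proof.
  intros Hf; eapply has_grad_eq.
  - apply has_grad_mult; [ apply has_grad_const | exact Hf ].
  - simpl; ring.
Qed.

Lemma has_grad_opp (f : C -> R) (z df : C) :
  has_grad f z df -> has_grad (fun u => - f u) z (- df)%C.
Proof.
  intros Hf; eapply has_grad_eq.
  - eapply has_grad_ext; [ | apply (has_grad_scal (-1)), Hf ].
    intros; simpl; ring.
  - C_ring.
Qed.

Lemma has_grad_inv (f : C -> R) (z df : C) :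
  has_grad f z df -> f z <> 0 ->
  has_grad (fun u => / f u) z (RtoC (- / (f z) ^ 2) * df)%C.
Proof.
  intros Hf H0.
  eapply has_grad_eq.
  - apply (has_grad_comp_pair (fun u => / Re u) f f z (- / (f z) ^ 2, 0)); eauto.
    apply (differentiable_pt_lim_proj1_0 Rinv); simpl.
    apply is_derive_Reals; auto_derive; auto; field; auto.
  - destruct df; C_ring.
Qed.

Lemma has_grad_continuous (f : C -> R) (z d : C) :
  has_grad f z d -> continuous_at f z.
Proof. intros H; apply differentiable_continuity_pt; now exists (Re d), (Im d). Qed.

Lemma has_grad_path (f : C -> R) (p q : R -> R) (t dp dq : R) (d : C) :
  has_grad f (p t, q t) d -> is_derive p t dp -> is_derive q t dq ->
  is_derive (fun s => f (p s, q s)) t (Re d * dp + Im d * dq).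
Proof.
  intros Hf Hp Hq; apply is_derive_Reals.
  apply (derivable_pt_lim_comp_2d (fun x y => f (x, y)));
    auto; now apply is_derive_Reals.
Qed.

Lemma has_cderiv_eq (F : C -> C) (z d d' : C) :
  has_cderiv F z d -> d = d' -> has_cderiv F z d'.
Proof. now intros H <-. Qed.

Lemma has_cderiv_const (c z : C) : has_cderiv (fun _ => c) z 0.
Proof.
  split; eapply has_grad_eq; try apply has_grad_const; C_ring.
Qed.

Lemma has_cderiv_id (z : C) : has_cderiv (fun u => u) z 1.
Proof.
  split; eapply has_grad_eq; try apply has_grad_Re; try apply has_grad_Im;
    C_ring.
Qed.

Lemma has_cderiv_plus (F G : C -> C) (z dF dG : C) :
  has_cderiv F z dF -> has_cderiv G z dG ->
  has_cderiv (fun u => F u + G u)%C z (dF + dG)%C.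
Proof.
  intros [F1 F2] [G1 G2]; split; simpl.
  - eapply has_grad_eq.
    + apply (has_grad_plus (fun u => Re (F u)) (fun u => Re (G u))); eassumption.
    + C_ring.
  - eapply has_grad_eq.
    + apply (has_grad_plus (fun u => Im (F u)) (fun u => Im (G u))); eassumption.
    + C_ring.
Qed.

Lemma has_cderiv_mult (F G : C -> C) (z dF dG : C) :
  has_cderiv F z dF -> has_cderiv G z dG ->
  has_cderiv (fun u => F u * G u)%C z (F z * dG + dF * G z)%C.
Proof.
  intros [F1 F2] [G1 G2]; split; simpl.
  - eapply has_grad_eq.
    + apply (has_grad_plus (fun u => Re (F u) * Re (G u))
               (fun u => - (Im (F u) * Im (G u)))).
      * apply has_grad_mult; eassumption.
      * apply (has_grad_opp (fun u => Im (F u) * Im (G u))), has_grad_mult; eassumption.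
    + C_ring.
  - eapply has_grad_eq.
    + apply (has_grad_plus (fun u => Re (F u) * Im (G u))
               (fun u => Im (F u) * Re (G u)));
        apply has_grad_mult; eassumption.
    + C_ring.
Qed.

Lemma Cmod2_neq_0 (z : C) : z <> 0 -> fst z ^ 2 + snd z ^ 2 <> 0.
Proof.
  intros Hz H; apply Hz.
  destruct z as [x y]; simpl in H.
  unfold RtoC; f_equal; nra.
Qed.

Lemma has_cderiv_inv (F : C -> C) (z dF : C) :
  has_cderiv F z dF -> F z <> 0 ->
  has_cderiv (fun u => / F u)%C z (- dF * / F z * / F z)%C.
Proof.
  intros [F1 F2] H0.
  pose proof (Cmod2_neq_0 _ H0) as Hn.
  assert (HN := has_grad_plus _ _ _ _ _ (has_grad_mult _ _ _ _ _ F1 F1)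
                  (has_grad_mult _ _ _ _ _ F2 F2)); cbv beta in HN.
  (* [HN] becomes the gradient of [1 / |F|^2], the real factor in [1 / F = conj(F) / |F|^2]. *)
  apply has_grad_inv in HN; [ | simpl in Hn; unfold Re, Im; nra ].
  split; simpl.
  - eapply has_grad_eq.
    + eapply has_grad_ext; [ | apply has_grad_mult; [ exact F1 | exact HN ] ].
      intros u; unfold Re, Im, Rdiv; simpl; do 2 f_equal; ring.
    + unfold Re, Im, RtoC, Cinv, Copp, Cplus, Cmult in *; simpl in *; f_equal; field;
        repeat split; intros E; apply Hn; rewrite <- E; ring.
  - eapply has_grad_eq.
    + eapply has_grad_ext; [ | apply has_grad_opp, has_grad_mult; [ exact F2 | exact HN ] ].
      intros u; unfold Re, Im, Rdiv; simpl.
      replace (fst (F u) * (fst (F u) * 1) + snd (F u) * (snd (F u) * 1))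
        with (fst (F u) * fst (F u) + snd (F u) * snd (F u)) by ring; ring.
    + unfold Re, Im, RtoC, Cinv, Copp, Cplus, Cmult in *; simpl in *; f_equal; field;
        repeat split; intros E; apply Hn; rewrite <- E; ring.
Qed.

(** By the Cauchy-Riemann equations the transposed Jacobian of [F] acts on gradients, encoded as
    complex numbers, as multiplication by the conjugate of the derivative. *)
Lemma has_grad_comp_cderiv (w : C -> R) (F : C -> C) (z d g : C) :
  has_cderiv F z d -> has_grad w (F z) g ->
  has_grad (fun u => w (F u)) z (g * Cconj d)%C.
Proof.
  intros [H1 H2] Hw.
  eapply has_grad_eq.
  - eapply has_grad_ext;
      [ | apply (has_grad_comp_pair w (fun u => Re (F u)) (fun u => Im (F u)) z g) ].
    + intros u; cbv beta; now destruct (F u).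
    + revert Hw; now destruct (F z).
    + exact H1.
    + exact H2.
  - C_ring.
Qed.

Lemma continuous_at_comp (w p q : C -> R) (z : C) :
  continuous_at w (p z, q z) -> continuous_at p z -> continuous_at q z ->
  continuous_at (fun u => w (p u, q u)) z.
Proof.
  intros Hw Hp Hq eps.
  destruct (Hw eps) as [d Hd].
  generalize (locally_2d_and _ _ _ _ (Hp d) (Hq d)).
  apply locally_2d_impl, locally_2d_forall.
  destruct z as [x0 y0]; simpl in *.
  intros x y [H1 H2]; now apply Hd.
Qed.
(** * Real harmonic functions: the gradient at the centre *)

(** The gradient is a parameter so that estimates can name it; the second partials stay existential.
    Their continuity allows differentiation under the integral sign and integration by parts on
    circles. *)
Definition harmonic_with_grad (w wx wy : C -> R) : Prop :=
  exists wxx wxy wyx wyy : C -> R, forall z : C, unit_disc z ->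
    (has_grad w z (wx z, wy z) /\
     has_grad wx z (wxx z, wxy z) /\ has_grad wy z (wyx z, wyy z)) /\
    (continuous_at wxx z /\ continuous_at wxy z /\
     continuous_at wyx z /\ continuous_at wyy z) /\
    wxx z + wyy z = 0.

Lemma unit_disc_sqr (z : C) : unit_disc z <-> fst z ^ 2 + snd z ^ 2 < 1.
Proof.
  unfold unit_disc, Cmod; rewrite <- sqrt_1 at 1; split; intros H.
  - now apply sqrt_lt_0_alt.
  - apply sqrt_lt_1_alt; split; [ nra | exact H ].
Qed.

(** * Polar coordinates and integrals over circles *)

Definition polar (r t : R) : C := (r * cos t, r * sin t).

Lemma unit_disc_polar (r t : R) : -1 < r < 1 -> unit_disc (polar r t).
Proof.
  intros Hr; apply unit_disc_sqr; unfold polar; simpl.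
  generalize (sin2_cos2 t); unfold Rsqr; nra.
Qed.

Lemma continuity_2d_slice (g : R -> R -> R) (r t : R) :
  continuity_2d_pt g r t -> continuous (g r) t.
Proof.
  intros H; apply filterlim_locally; intros eps.
  apply (locally_2d_1d_const_x _ _ _ (H eps)).
Qed.

Lemma continuity_2d_cos (r t : R) : continuity_2d_pt (fun _ s => cos s) r t.
Proof.
  apply (continuity_1d_2d_pt_comp cos (fun _ s => s)).
  - apply continuity_cos.
  - apply continuity_2d_pt_id2.
Qed.

Lemma continuity_2d_sin (r t : R) : continuity_2d_pt (fun _ s => sin s) r t.
Proof.
  apply (continuity_1d_2d_pt_comp sin (fun _ s => s)).
  - apply continuity_sin.
  - apply continuity_2d_pt_id2.
Qed.

Lemma continuity_2d_polar (w : C -> R) (r t : R) :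
  continuous_at w (polar r t) -> continuity_2d_pt (fun r t => w (polar r t)) r t.
Proof.
  intros H.
  apply (continuous_at_comp w (fun u => Re u * cos (Im u)) (fun u => Re u * sin (Im u))
           (r, t)); [ exact H | | ];
    apply continuity_2d_pt_mult; simpl;
    first [ apply continuity_2d_pt_id1 | apply continuity_2d_cos
          | apply continuity_2d_sin ].
Qed.

Lemma locally_open_interval (a b x : R) :
  a < x < b -> locally x (fun y : R => a < y < b).
Proof.
  intros Hx; apply (locally_interval _ x (Finite a) (Finite b)); simpl; tauto.
Qed.

Lemma ex_RInt_slice (g : R -> R -> R) (r a b : R) :
  (forall t, continuity_2d_pt g r t) -> ex_RInt (g r) a b.
Proof.
  intros H; apply (ex_RInt_continuous (V := R_CompleteNormedModule)).
  intros t _; now apply continuity_2d_slice.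
Qed.

Lemma is_derive_RInt_slice (g dg : R -> R -> R) (a b r : R) :
  (forall r t, -1 < r < 1 -> is_derive (fun s => g s t) r (dg r t)) ->
  (forall r t, -1 < r < 1 -> continuity_2d_pt g r t) ->
  (forall r t, -1 < r < 1 -> continuity_2d_pt dg r t) ->
  -1 < r < 1 ->
  is_derive (fun s => RInt (g s) a b) r (RInt (dg r) a b).
Proof.
  intros Hd Hg Hdg Hr.
  replace (RInt (dg r) a b) with (RInt (fun t => Derive (fun s => g s t) r) a b)
    by (apply RInt_ext; intros; now apply is_derive_unique, Hd).
  pose proof (locally_open_interval _ _ _ Hr) as Hloc.
  apply (is_derive_RInt_param g a b r).
  - eapply filter_imp; [ | exact Hloc ]; intros s Hs t _; eexists; now apply Hd.
  - intros t _.
    apply (continuity_2d_pt_ext_loc dg); [ | now apply Hdg ].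
    destruct Hloc as [d Hd'].
    exists d; intros u v Hu _; symmetry; apply is_derive_unique, Hd, Hd', Hu.
  - eapply filter_imp; [ | exact Hloc ]; intros s Hs; apply ex_RInt_slice; auto.
Qed.

Lemma constant_of_derive_0 (f : R -> R) (r : R) :
  0 < r -> (forall s, 0 <= s <= r -> exists d, is_derive f s d) ->
  (forall s, 0 < s < r -> is_derive f s 0) -> f r = f 0.
Proof.
  intros Hr Hd H0.
  destruct (MVT_cor2 f (Derive f) 0 r Hr) as [c [Hc Hc']].
  - intros c Hc; apply is_derive_Reals, Derive_correct, Hd, Hc.
  - rewrite (is_derive_unique _ _ _ (H0 c Hc')) in Hc; lra.
Qed.

(** For [g] of period [2 PI] this is [PI] times its first cosine Fourier coefficient. The period
    starts at [- PI / 2] so that [cos] changes sign inside it only at [PI / 2]. *)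
Definition RInt_against_cos (g : R -> R) : R :=
  RInt (fun t => g t * cos t) (- (PI / 2)) (3 * (PI / 2)).

Lemma RInt_of_derive (f df : R -> R) (a b : R) :
  (forall x, is_derive f x (df x)) -> (forall x, continuous df x) ->
  RInt df a b = f b - f a.
Proof.
  intros; apply is_RInt_unique, (is_RInt_derive f df); auto.
Qed.

Lemma cos_3PI2 : cos (3 * (PI / 2)) = 0.
Proof.
  replace (3 * (PI / 2)) with (PI / 2 + PI) by field.
  rewrite neg_cos, cos_PI2; ring.
Qed.

Lemma sin_3PI2 : sin (3 * (PI / 2)) = -1.
Proof.
  replace (3 * (PI / 2)) with (PI / 2 + PI) by field.
  rewrite neg_sin, sin_PI2; ring.
Qed.

Lemma cos_mPI2 : cos (- (PI / 2)) = 0.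
Proof. rewrite cos_neg; apply cos_PI2. Qed.

Lemma sin_mPI2 : sin (- (PI / 2)) = -1.
Proof. rewrite sin_neg, sin_PI2; ring. Qed.

(* [cos] is nonnegative on the first half of the period, nonpositive on the second. *)
Lemma RInt_against_cos_bound (g : R -> R) (M : R) :
  (forall t, continuous g t) -> (forall t, Rabs (g t) <= M) -> RInt_against_cos g <= 4 * M.
Proof.
  intros Hg HM; unfold RInt_against_cos.
  pose proof PI_RGT_0.
  assert (Hc : forall t, continuous (fun t => g t * cos t) t).
  { intros t; apply (continuous_mult g cos); [ apply Hg | ].
    apply continuity_pt_filterlim, continuity_cos. }
  assert (Hk : forall k t, continuous (fun t => k * cos t) t).
  { intros k t; apply (continuous_mult (fun _ => k) cos); [ apply continuous_const | ].
    apply continuity_pt_filterlim, continuity_cos. }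
  assert (Hex : forall a b, ex_RInt (fun t => g t * cos t) a b)
    by (intros; apply (ex_RInt_continuous (V := R_CompleteNormedModule)); auto).
  assert (Hexk : forall k a b, ex_RInt (fun t => k * cos t) a b)
    by (intros; apply (ex_RInt_continuous (V := R_CompleteNormedModule)); auto).
  assert (Hv : forall k a b, RInt (fun t => k * cos t) a b = k * sin b - k * sin a).
  { intros k a b; apply (RInt_of_derive (fun t => k * sin t)); auto.
    intros x; auto_derive; auto; ring. }
  rewrite <- (RInt_Chasles (V := R_CompleteNormedModule)
                (fun t => g t * cos t) _ (PI / 2) _) by auto.
  assert (H1 : RInt (fun t => g t * cos t) (- (PI / 2)) (PI / 2)
               <= RInt (fun t => M * cos t) (- (PI / 2)) (PI / 2)).
  { apply RInt_le; auto; [ lra | ].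
    intros t Ht; assert (0 <= cos t) by (apply cos_ge_0; lra).
    specialize (HM t); apply Rabs_le_between in HM; nra. }
  assert (H2 : RInt (fun t => g t * cos t) (PI / 2) (3 * (PI / 2))
               <= RInt (fun t => - M * cos t) (PI / 2) (3 * (PI / 2))).
  { apply RInt_le; auto; [ lra | ].
    intros t Ht; assert (cos t <= 0) by (apply cos_le_0; lra).
    specialize (HM t); apply Rabs_le_between in HM; nra. }
  rewrite Hv in H1, H2; rewrite sin_PI2, sin_mPI2 in H1; rewrite sin_PI2, sin_3PI2 in H2.
  unfold plus; simpl; lra.
Qed.

Lemma RInt_against_cos_cos_sin (a b : R) :
  RInt_against_cos (fun t => cos t * a + sin t * b) = PI * a.
Proof.
  unfold RInt_against_cos.
  (* Antiderivative of [cos^2 a + sin cos b]; its second term takes the same value at both ends. *)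
  rewrite (RInt_of_derive (fun t => (t + sin t * cos t) / 2 * a + sin t ^ 2 / 2 * b)).
  - rewrite sin_3PI2, sin_mPI2, cos_3PI2, cos_mPI2; field.
  - intros x; auto_derive; auto.
    generalize (sin2_cos2 x); unfold Rsqr; intros E.
    apply Rminus_diag_uniq.
    transitivity (a / 2 * (1 - (sin x * sin x + cos x * cos x))); [ field | ].
    rewrite E; field.
  - intros x; apply (ex_derive_continuous (V := R_NormedModule)); auto_derive; auto.
Qed.

(** The Fourier coefficient [F r] of [w] on the circle of radius [r] solves an Euler equation, which
    with regularity at [0] forces [F r = PI * wx 0 * r]. The bound [4 * M] on [F] then passes to the
    limit as [r] tends to 1. *)
Lemma harmonic_grad_centre (w wx wy : C -> R) (M : R) :
  harmonic_with_grad w wx wy -> (forall z, unit_disc z -> Rabs (w z) <= M) ->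
  PI * wx 0 <= 4 * M.
Proof.
  intros (wxx & wxy & wyx & wyy & Hw) HM.
  assert (HP : forall r t, -1 < r < 1 -> unit_disc (polar r t))
    by (intros; now apply unit_disc_polar).
  (* [W] is [w] in polar coordinates; the suffixes [r] and [t] denote its partial derivatives,
     written out by the chain rule. *)
  set (W := fun r t => w (polar r t)).
  set (Wr := fun r t => cos t * wx (polar r t) + sin t * wy (polar r t)).
  set (Wrr := fun r t =>
    cos t * (cos t * wxx (polar r t) + sin t * wxy (polar r t)) +
    sin t * (cos t * wyx (polar r t) + sin t * wyy (polar r t))).
  set (Wt := fun r t => r * (cos t * wy (polar r t) - sin t * wx (polar r t))).
  set (Wtt := fun r t =>
    r * (- sin t * wy (polar r t) - cos t * wx (polar r t) +
         cos t * r * (cos t * wyy (polar r t) - sin t * wyx (polar r t)) -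
         sin t * r * (cos t * wxy (polar r t) - sin t * wxx (polar r t)))).
  assert (radial : forall (f : C -> R) g r t, has_grad f (polar r t) g ->
            is_derive (fun s => f (polar s t)) r (cos t * Re g + sin t * Im g)).
  { intros f g r t Hf.
    replace (cos t * Re g + sin t * Im g) with (Re g * cos t + Im g * sin t) by ring.
    apply (has_grad_path f (fun s => s * cos t) (fun s => s * sin t)); [ exact Hf | | ];
      auto_derive; auto; ring. }
  assert (angular : forall (f : C -> R) g r t, has_grad f (polar r t) g ->
            is_derive (fun s => f (polar r s)) t (r * (cos t * Im g - sin t * Re g))).
  { intros f g r t Hf.
    replace (r * (cos t * Im g - sin t * Re g))
      with (Re g * (r * - sin t) + Im g * (r * cos t)) by ring.
    apply (has_grad_path f (fun s => r * cos s) (fun s => r * sin s)); [ exact Hf | | ];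
      auto_derive; auto; ring. }
  assert (HWr : forall r t, -1 < r < 1 -> is_derive (fun s => W s t) r (Wr r t)).
  { intros r t Hr; destruct (Hw _ (HP r t Hr)) as [[H _] _]; exact (radial _ _ _ _ H). }
  assert (HWrr : forall r t, -1 < r < 1 -> is_derive (fun s => Wr s t) r (Wrr r t)).
  { intros r t Hr; destruct (Hw _ (HP r t Hr)) as [[_ [H1 H2]] _].
    apply radial in H1, H2.
    apply (is_derive_plus (fun s => cos t * wx (polar s t)) (fun s => sin t * wy (polar s t)));
      now apply (is_derive_scal (fun s => _ (polar s t))). }
  assert (HWt : forall r t, -1 < r < 1 -> is_derive (fun s => W r s) t (Wt r t)).
  { intros r t Hr; destruct (Hw _ (HP r t Hr)) as [[H _] _]; exact (angular _ _ _ _ H). }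
  assert (HWtt : forall r t, -1 < r < 1 -> is_derive (fun s => Wt r s) t (Wtt r t)).
  { intros r t Hr; destruct (Hw _ (HP r t Hr)) as [[_ [H1 H2]] _].
    apply angular in H1, H2; simpl in H1, H2.
    evar_last.
    - apply is_derive_scal, (is_derive_minus (fun s => cos s * wy (polar r s))
                              (fun s => sin s * wx (polar r s)));
      apply (is_derive_mult (_ : R -> R) (fun s => _ (polar r s))); try eassumption;
        try (intros; apply Rmult_comm);
      auto_derive; auto; reflexivity.
    - unfold Wtt, minus, plus, opp, mult; simpl; ring. }
  assert (CW : forall r t, -1 < r < 1 -> continuity_2d_pt W r t).
  { intros r t Hr; apply continuity_2d_polar.
    destruct (Hw _ (HP r t Hr)) as [[H _] _]; exact (has_grad_continuous _ _ _ H). }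
  assert (CWx : forall r t, -1 < r < 1 ->
            continuity_2d_pt (fun r t => wx (polar r t)) r t /\
            continuity_2d_pt (fun r t => wy (polar r t)) r t).
  { intros r t Hr; destruct (Hw _ (HP r t Hr)) as [[_ [H1 H2]] _].
    split; apply continuity_2d_polar; eapply has_grad_continuous; eassumption. }
  assert (CWr : forall r t, -1 < r < 1 -> continuity_2d_pt Wr r t).
  { intros r t Hr; destruct (CWx r t Hr).
    apply continuity_2d_pt_plus; apply continuity_2d_pt_mult;
      auto using continuity_2d_cos, continuity_2d_sin. }
  assert (CWrr : forall r t, -1 < r < 1 -> continuity_2d_pt Wrr r t).
  { intros r t Hr; destruct (Hw _ (HP r t Hr)) as [_ [[H1 [H2 [H3 H4]]] _]].
    apply continuity_2d_polar in H1, H2, H3, H4.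
    repeat first [ apply continuity_2d_pt_plus | apply continuity_2d_pt_mult ];
      auto using continuity_2d_cos, continuity_2d_sin. }
  assert (Ccos : forall g r t, continuity_2d_pt g r t ->
            continuity_2d_pt (fun r t => g r t * cos t) r t)
    by (intros; apply continuity_2d_pt_mult; auto using continuity_2d_cos).
  set (F := fun r => RInt_against_cos (W r)).
  set (K := fun r => RInt_against_cos (Wr r)).
  set (L := fun r => RInt_against_cos (Wrr r)).
  assert (Dcos : forall (g : R -> R) x l t, is_derive g x l ->
            is_derive (fun s => g s * cos t) x (l * cos t)).
  { intros g x l t H.
    apply (is_derive_ext (fun s => cos t * g s)); [ intros; apply Rmult_comm | ].
    rewrite Rmult_comm; now apply is_derive_scal. }
  assert (HF : forall r, -1 < r < 1 -> is_derive F r (K r)).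
  { intros r Hr.
    apply (is_derive_RInt_slice (fun r t => W r t * cos t) (fun r t => Wr r t * cos t)); auto. }
  assert (HK : forall r, -1 < r < 1 -> is_derive K r (L r)).
  { intros r Hr.
    apply (is_derive_RInt_slice (fun r t => Wr r t * cos t) (fun r t => Wrr r t * cos t)); auto. }
  (* The polar Laplace equation [r^2 W_rr + r W_r + W_tt = 0], integrated by parts twice
     against [cos]. *)
  assert (ODE : forall r, -1 < r < 1 -> r ^ 2 * L r + r * K r - F r = 0).
  { intros r Hr.
    assert (X : forall g : R -> R -> R, (forall t, continuity_2d_pt g r t) ->
              is_RInt (fun t => g r t * cos t) (- (PI / 2)) (3 * (PI / 2))
                (RInt_against_cos (g r))).
    { intros g Hg; apply (RInt_correct (V := R_CompleteNormedModule)).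
      apply (ex_RInt_slice (fun r t => g r t * cos t)); auto. }
    assert (E : r ^ 2 * L r + r * K r - F r =
                RInt (fun t => - (Wtt r t + W r t) * cos t) (- (PI / 2)) (3 * (PI / 2))).
    { symmetry; apply is_RInt_unique.
      apply (is_RInt_ext (fun t => minus (plus (scal (r ^ 2) (Wrr r t * cos t))
                                          (scal r (Wr r t * cos t))) (W r t * cos t))).
      - intros t _; destruct (Hw _ (HP r t Hr)) as [_ [_ H]].
        unfold minus, plus, opp, scal; simpl; unfold mult; simpl.
        unfold Wrr, Wtt, Wr.
        replace (wyy (polar r t)) with (- wxx (polar r t)) by lra.
        ring.
      - exact (is_RInt_minus _ _ _ _ _ _
                 (is_RInt_plus _ _ _ _ _ _ (is_RInt_scal _ _ _ (r ^ 2) _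
                       (X Wrr (fun t => CWrr r t Hr)))
                    (is_RInt_scal _ _ _ r _ (X Wr (fun t => CWr r t Hr))))
                 (X W (fun t => CW r t Hr))). }
    rewrite E.
    (* The boundary terms cancel: at both ends [cos] is 0, [sin] is -1 and the point of the circle
       is the same. *)
    rewrite (RInt_of_derive (fun t => - (Wt r t * cos t + W r t * sin t))).
    - rewrite cos_3PI2, cos_mPI2, sin_3PI2, sin_mPI2.
      unfold W, polar; rewrite cos_3PI2, cos_mPI2, sin_3PI2, sin_mPI2; ring.
    - intros t; evar_last.
      + apply (is_derive_opp (V := R_NormedModule)), (is_derive_plus (V := R_NormedModule)
          (fun s => Wt r s * cos s) (fun s => W r s * sin s)).
        * apply (is_derive_mult (Wt r) cos t); [ apply HWtt, Hr | | intros; apply Rmult_comm ].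
          auto_derive; auto; reflexivity.
        * apply (is_derive_mult (W r) sin t); [ apply HWt, Hr | | intros; apply Rmult_comm ].
          auto_derive; auto; reflexivity.
      + unfold opp, plus, mult; simpl; ring.
    - intros t; apply (continuity_2d_slice (fun r t => - (Wtt r t + W r t) * cos t)).
      destruct (Hw _ (HP r t Hr)) as [_ [[H1 [H2 [H3 H4]]] _]].
      apply continuity_2d_polar in H1, H2, H3, H4.
      destruct (CWx r t Hr).
      apply Ccos, continuity_2d_pt_opp, continuity_2d_pt_plus; [ | auto ].
      repeat first [ apply continuity_2d_pt_plus | apply continuity_2d_pt_minus
                   | apply continuity_2d_pt_mult | apply continuity_2d_pt_opp ];
        auto using continuity_2d_cos, continuity_2d_sin, continuity_2d_pt_id1. }
  (* As [F' = K] and [K' = L], the derivative of [s * (s * K s - F s)] is the left side of [ODE],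
     hence zero; the function vanishes at 0. *)
  assert (HE : forall r, 0 <= r < 1 -> r * (r * K r - F r) = 0).
  { intros r [Hr0 Hr1]; destruct (Req_dec r 0) as [-> | Hn]; [ ring | ].
    assert (D : forall s, 0 <= s <= r -> is_derive (fun s => s * (s * K s - F s)) s 0).
    { intros s Hs; assert (Hs' : -1 < s < 1) by lra.
      evar_last.
      - apply (is_derive_mult (fun s => s) (fun s => s * K s - F s));
          [ apply is_derive_id | | intros; apply Rmult_comm ].
        apply (is_derive_minus (fun s => s * K s) F); [ | now apply HF ].
        apply (is_derive_mult (fun s => s) K);
          [ apply is_derive_id | now apply HK | intros; apply Rmult_comm ].
      - specialize (ODE s Hs').
        unfold minus, plus, opp, mult, one; simpl; unfold mult; simpl; lra. }
    rewrite (constant_of_derive_0 (fun s => s * (s * K s - F s)) r); [ ring | lra | | ].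
    - intros s Hs; exists 0; now apply D.
    - intros s Hs; apply D; lra. }
  (* Inserting [F s = s * K s] into [ODE] leaves [s ^ 2 * L s = 0], so [K] is constant. At radius 0
     the gradient does not depend on the angle and the integral is explicit. *)
  assert (HKr : forall r, 0 < r < 1 -> K r = PI * wx 0).
  { intros r Hr.
    rewrite (constant_of_derive_0 K r); [ | lra | | ].
    - unfold K, Wr, polar.
      erewrite <- RInt_against_cos_cos_sin; f_equal; apply functional_extensionality; intros t.
      rewrite !Rmult_0_l; reflexivity.
    - intros s Hs; exists (L s); apply HK; lra.
    - intros s Hs; replace 0 with (L s); [ apply HK; lra | ].
      assert (Hs' : -1 < s < 1) by lra.
      specialize (ODE s Hs'); specialize (HE s (conj (Rlt_le _ _ (proj1 Hs)) (proj2 Hs'))).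
      apply Rmult_integral in HE; destruct HE as [HE | HE]; [ lra | ].
      assert (s ^ 2 * L s = 0) as E0 by lra.
      apply Rmult_integral in E0; destruct E0 as [E0 | E0]; [ nra | exact E0 ]. }
  assert (HB : forall r, 0 < r < 1 -> r * (PI * wx 0) <= 4 * M).
  { intros r Hr; rewrite <- (HKr r Hr).
    destruct (Rmult_integral _ _ (HE r (conj (Rlt_le _ _ (proj1 Hr)) (proj2 Hr))))
      as [E | E]; [ lra | ].
    replace (r * K r) with (F r) by lra.
    apply RInt_against_cos_bound.
    - intros t; apply continuity_2d_slice, CW; lra.
    - intros t; apply HM, HP; lra. }
  apply Rnot_lt_le; intros Hlt.
  assert (0 <= M) by (eapply Rle_trans; [ apply Rabs_pos | apply (HM 0) ];
                        apply unit_disc_sqr; simpl; lra).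
  set (m := PI * wx 0) in *.
  (* This radius is the midpoint of [4 * M / m] and 1; [HB] there gives [(4 * M + m) / 2 <= 4 * M],
     against [4 * M < m]. *)
  specialize (HB ((4 * M + m) / (2 * m))).
  assert (0 < (4 * M + m) / (2 * m) < 1).
  { split; [ apply Rdiv_lt_0_compat | apply Rlt_div_l ]; lra. }
  specialize (HB H0).
  replace ((4 * M + m) / (2 * m) * m) with ((4 * M + m) / 2) in HB by (field; lra).
  lra.
Qed.

(** * Conformal invariance and the Schwarz-Pick lemma *)

Lemma continuous_at_plus (f g : C -> R) (z : C) :
  continuous_at f z -> continuous_at g z -> continuous_at (fun u => f u + g u) z.
Proof. apply continuity_2d_pt_plus. Qed.

Lemma continuous_at_mult (f g : C -> R) (z : C) :
  continuous_at f z -> continuous_at g z -> continuous_at (fun u => f u * g u) z.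
Proof. apply continuity_2d_pt_mult. Qed.

Lemma continuous_at_opp (f : C -> R) (z : C) :
  continuous_at f z -> continuous_at (fun u => - f u) z.
Proof. apply continuity_2d_pt_opp. Qed.

Lemma has_cderiv_continuous (F : C -> C) (z d : C) :
  has_cderiv F z d ->
  continuous_at (fun u => Re (F u)) z /\ continuous_at (fun u => Im (F u)) z.
Proof. intros [H1 H2]; split; eapply has_grad_continuous; eassumption. Qed.

Lemma continuous_at_comp_cderiv (w : C -> R) (F : C -> C) (z d : C) :
  has_cderiv F z d -> continuous_at w (F z) -> continuous_at (fun u => w (F u)) z.
Proof.
  intros HF Hw; apply has_cderiv_continuous in HF as [H1 H2].
  eapply continuity_2d_pt_ext;
    [ | apply (continuous_at_comp w (fun u => Re (F u)) (fun u => Im (F u)) z) ].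
  - intros x y; cbv beta; now destruct (F (x, y)).
  - revert Hw; now destruct (F z).
  - exact H1.
  - exact H2.
Qed.

(** [F1] and [F2] are the first two complex derivatives of [F]. In the Laplacian of the composition
    the terms with [F2] cancel and [|F1|^2 (wxx + wyy)] remains. *)
Lemma harmonic_comp (w wx wy : C -> R) (F F1 F2 : C -> C) :
  harmonic_with_grad w wx wy ->
  (forall z, unit_disc z -> unit_disc (F z) /\
     has_cderiv F z (F1 z) /\ has_cderiv F1 z (F2 z) /\
     continuous_at (fun u => Re (F2 u)) z /\ continuous_at (fun u => Im (F2 u)) z) ->
  harmonic_with_grad (fun z => w (F z))
    (fun z => Re (F1 z) * wx (F z) + Im (F1 z) * wy (F z))
    (fun z => Re (F1 z) * wy (F z) + - (Im (F1 z) * wx (F z))).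
Proof.
  intros (wxx & wxy & wyx & wyy & Hw) HF.
  set (a z := Re (F1 z)); set (b z := Im (F1 z)).
  exists (fun z => (a z * (a z * wxx (F z) + b z * wxy (F z)) + wx (F z) * Re (F2 z)) +
             (b z * (a z * wyx (F z) + b z * wyy (F z)) + wy (F z) * Im (F2 z))).
  exists (fun z => (a z * (- (b z * wxx (F z)) + a z * wxy (F z)) + - (wx (F z) * Im (F2 z))) +
             (b z * (- (b z * wyx (F z)) + a z * wyy (F z)) + wy (F z) * Re (F2 z))).
  exists (fun z => (a z * (a z * wyx (F z) + b z * wyy (F z)) + wy (F z) * Re (F2 z)) +
             - (b z * (a z * wxx (F z) + b z * wxy (F z)) + wx (F z) * Im (F2 z))).
  exists (fun z => (a z * (- (b z * wyx (F z)) + a z * wyy (F z)) + - (wy (F z) * Im (F2 z))) +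
             - (b z * (- (b z * wxx (F z)) + a z * wxy (F z)) + wx (F z) * Re (F2 z))).
  intros z Hz.
  destruct (HF z Hz) as (HFz & H1 & [H2a H2b] & C1 & C2).
  destruct (Hw _ HFz) as [[G [Gx Gy]] [[Cxx [Cxy [Cyx Cyy]]] L]].
  apply (fun h => continuous_at_comp_cderiv _ _ _ _ h Cxx) in H1 as Cxx'.
  apply (fun h => continuous_at_comp_cderiv _ _ _ _ h Cxy) in H1 as Cxy'.
  apply (fun h => continuous_at_comp_cderiv _ _ _ _ h Cyx) in H1 as Cyx'.
  apply (fun h => continuous_at_comp_cderiv _ _ _ _ h Cyy) in H1 as Cyy'.
  pose proof (has_grad_comp_cderiv _ _ _ _ _ H1 G) as DG.
  pose proof (has_grad_comp_cderiv _ _ _ _ _ H1 Gx) as DGx.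
  pose proof (has_grad_comp_cderiv _ _ _ _ _ H1 Gy) as DGy.
  pose proof (has_grad_continuous _ _ _ DGx) as CGx.
  pose proof (has_grad_continuous _ _ _ DGy) as CGy.
  pose proof (has_grad_continuous _ _ _ H2a) as Ca.
  pose proof (has_grad_continuous _ _ _ H2b) as Cb.
  split; [ split; [ | split ] | split; [ | ] ];
    [ | | | refine (conj _ (conj _ (conj _ _)));
            repeat first [ assumption | apply continuous_at_plus | apply continuous_at_opp
                         | apply continuous_at_mult ] | ].
  - eapply has_grad_eq; [ exact DG | C_ring ].
  - eapply has_grad_eq.
    + apply (has_grad_plus (fun z => a z * wx (F z)) (fun z => b z * wy (F z)));
        apply (has_grad_mult (_ : C -> R) (fun u => _ (F u))); eassumption.
    + unfold a, b; C_ring.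
  - eapply has_grad_eq.
    + apply (has_grad_plus (fun z => a z * wy (F z)) (fun z => - (b z * wx (F z))));
        [ | apply (has_grad_opp (fun z => b z * wx (F z))) ];
        apply (has_grad_mult (_ : C -> R) (fun u => _ (F u))); eassumption.
    + unfold a, b; C_ring.
  - replace (wyy (F z)) with (- wxx (F z)) by lra; ring.
Qed.

(* For [|e| = 1], the automorphism of the disc sending [0] to [a] with derivative of
   argument [e] at [0]. *)
Definition moebius (a e z : C) : C := ((e * z + a) * / (1 + Cconj a * e * z))%C.

(** [moebius1] and [moebius2] are the first and second complex derivatives of [moebius a e]. *)
Definition moebius1 (a e z : C) : C :=
  (e * (1 - a * Cconj a) * / (1 + Cconj a * e * z) * / (1 + Cconj a * e * z))%C.

Definition moebius2 (a e z : C) : C :=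
  (- (2) * Cconj a * e * moebius1 a e z * / (1 + Cconj a * e * z))%C.

Lemma unit_disc_neq_1 (z : C) : unit_disc z -> (1 + z <> 0)%C.
Proof.
  intros Hz E; revert Hz; unfold unit_disc.
  replace z with (- (1))%C.
  - rewrite Cmod_opp, Cmod_1; lra.
  - replace z with ((1 + z) - 1)%C by ring; rewrite E; ring.
Qed.

Lemma moebius_denom (a e z : C) :
  unit_disc a -> Cmod e = 1 -> unit_disc z -> (1 + Cconj a * e * z <> 0)%C.
Proof.
  intros Ha He Hz; apply unit_disc_neq_1; unfold unit_disc in *.
  rewrite !Cmod_mult, Cmod_conj, He.
  pose proof (Cmod_ge_0 a); pose proof (Cmod_ge_0 z); nra.
Qed.

(** With [u = e z] this is [|1 + conj(a) u|^2 - |u + a|^2 = (1 - |a|^2) (1 - |u|^2)]. It yields both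
    the invariance of the disc and the hyperbolic speed of the geodesics. *)
Lemma one_minus_Cmod2_moebius (a e z : C) :
  unit_disc a -> Cmod e = 1 -> unit_disc z ->
  1 - Cmod (moebius a e z) ^ 2 =
  (1 - Cmod a ^ 2) * (1 - Cmod z ^ 2) * / Cmod (1 + Cconj a * e * z) ^ 2.
Proof.
  intros Ha He Hz; pose proof (moebius_denom a e z Ha He Hz) as Hd.
  unfold moebius; rewrite Cmod_mult, Cmod_inv by exact Hd.
  assert (Hd' : 0 < Cmod (1 + Cconj a * e * z)) by now apply Cmod_gt_0.
  assert (E : Cmod (1 + Cconj a * e * z) ^ 2 - Cmod (e * z + a) ^ 2 =
              (1 - Cmod a ^ 2) * (1 - Cmod z ^ 2)).
  { replace (Cmod z ^ 2) with (Cmod (e * z) ^ 2) by (rewrite Cmod_mult, He; ring).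
    replace (Cconj a * e * z)%C with (Cconj a * (e * z))%C by ring.
    generalize (e * z)%C; intros u; rewrite !Cmod2_alt.
    unfold Re, Im, Cplus, Cmult, Cconj, RtoC; simpl; ring. }
  rewrite <- E; field; lra.
Qed.

Lemma unit_disc_moebius (a e z : C) :
  unit_disc a -> Cmod e = 1 -> unit_disc z -> unit_disc (moebius a e z).
Proof.
  intros Ha He Hz; pose proof (one_minus_Cmod2_moebius a e z Ha He Hz) as E.
  pose proof (moebius_denom a e z Ha He Hz) as Hd; apply Cmod_gt_0 in Hd.
  assert (0 < 1 - Cmod (moebius a e z) ^ 2).
  { rewrite E; unfold unit_disc in *.
    pose proof (Cmod_ge_0 a); pose proof (Cmod_ge_0 z).
    apply Rmult_lt_0_compat; [ apply Rmult_lt_0_compat; nra | ].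
    apply Rinv_0_lt_compat, pow_lt, Hd. }
  unfold unit_disc; pose proof (Cmod_ge_0 (moebius a e z)); nra.
Qed.

Lemma has_cderiv_moebius_denom (a e z : C) :
  unit_disc a -> Cmod e = 1 -> unit_disc z ->
  has_cderiv (fun z => / (1 + Cconj a * e * z))%C z
    (- (Cconj a * e) * / (1 + Cconj a * e * z) * / (1 + Cconj a * e * z))%C.
Proof.
  intros Ha He Hz; pose proof (moebius_denom a e z Ha He Hz) as Hd.
  apply (has_cderiv_inv (fun z => 1 + Cconj a * e * z)%C); [ | exact Hd ].
  eapply has_cderiv_eq.
  - apply has_cderiv_plus; [ apply has_cderiv_const | ].
    apply has_cderiv_mult; [ apply has_cderiv_const | apply has_cderiv_id ].
  - cbv beta; ring.
Qed.

Lemma has_cderiv_moebius (a e z : C) :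
  unit_disc a -> Cmod e = 1 -> unit_disc z ->
  has_cderiv (moebius a e) z (moebius1 a e z).
Proof.
  intros Ha He Hz; eapply has_cderiv_eq.
  - apply has_cderiv_mult; [ | now apply has_cderiv_moebius_denom ].
    apply has_cderiv_plus; [ | apply has_cderiv_const ].
    apply has_cderiv_mult; [ apply has_cderiv_const | apply has_cderiv_id ].
  - unfold moebius1; cbv beta; field; now apply moebius_denom.
Qed.

Lemma has_cderiv_moebius1 (a e z : C) :
  unit_disc a -> Cmod e = 1 -> unit_disc z ->
  has_cderiv (moebius1 a e) z (moebius2 a e z).
Proof.
  intros Ha He Hz; eapply has_cderiv_eq.
  - apply has_cderiv_mult; [ apply has_cderiv_mult | ];
      try (apply has_cderiv_const || now apply has_cderiv_moebius_denom).
  - unfold moebius2, moebius1; cbv beta; field; now apply moebius_denom.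
Qed.

Lemma continuous_moebius2 (a e z : C) :
  unit_disc a -> Cmod e = 1 -> unit_disc z ->
  continuous_at (fun u => Re (moebius2 a e u)) z /\
  continuous_at (fun u => Im (moebius2 a e u)) z.
Proof.
  intros Ha He Hz; eapply has_cderiv_continuous.
  apply has_cderiv_mult; [ apply has_cderiv_mult | ];
    [ apply has_cderiv_const | now apply has_cderiv_moebius1
    | now apply has_cderiv_moebius_denom ].
Qed.

Lemma moebius_0 (a e : C) : moebius a e 0 = a.
Proof. unfold moebius; replace (1 + Cconj a * e * 0)%C with (RtoC 1) by ring; field. Qed.

(** Composition with [moebius a e] keeps the bound [M] and moves [a] to the centre. Its derivative
    at 0 is [(1 - |a|^2) e], so the x-derivative there is [1 - |a|^2] times the derivative of [w]
    along [e]. *)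
Lemma schwarz_pick_harmonic (w wx wy : C -> R) (M : R) (a e : C) :
  harmonic_with_grad w wx wy -> (forall z, unit_disc z -> Rabs (w z) <= M) ->
  unit_disc a -> Cmod e = 1 ->
  (1 - Cmod a ^ 2) * (Re e * wx a + Im e * wy a) <= 4 * M / PI.
Proof.
  intros Hw HM Ha He.
  assert (H : harmonic_with_grad (fun z => w (moebius a e z))
    (fun z => Re (moebius1 a e z) * wx (moebius a e z) + Im (moebius1 a e z) * wy (moebius a e z))
    (fun z => Re (moebius1 a e z) * wy (moebius a e z) +
              - (Im (moebius1 a e z) * wx (moebius a e z)))).
  { apply (harmonic_comp w wx wy (moebius a e) (moebius1 a e) (moebius2 a e)); [ exact Hw | ].
    intros z Hz; split; [ now apply unit_disc_moebius | ].
    split; [ now apply has_cderiv_moebius | ].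
    split; [ now apply has_cderiv_moebius1 | ].
    now apply continuous_moebius2. }
  apply (fun h => harmonic_grad_centre _ _ _ M h) in H;
    [ | intros z Hz; apply HM; now apply unit_disc_moebius ].
  cbv beta in H; rewrite moebius_0 in H.
  replace (moebius1 a e 0) with (RtoC (1 - Cmod a ^ 2) * e)%C in H.
  - rewrite re_scal_l, im_scal_l in H.
    pose proof PI_RGT_0.
    apply (Rle_div_r _ (4 * M) PI); [ assumption | ].
    eapply Rle_trans; [ apply Req_le | exact H ]; ring.
  - unfold moebius1; rewrite RtoC_minus, Cmod2_conj.
    replace (1 + Cconj a * e * 0)%C with (RtoC 1) by ring; field.
Qed.

(** * Components of complex harmonic mappings *)

Lemma locally_unit_disc (z : C) :
  unit_disc z -> locally_2d (fun x y => unit_disc (x, y)) (Re z) (Im z).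
Proof.
  intros Hz.
  (* Halving [1 - |z|] absorbs the factor [sqrt 2 <= 2] between the modulus and the larger
     coordinate. *)
  assert (0 < (1 - Cmod z) / 2) as Hd by (unfold unit_disc in Hz; lra).
  exists (mkposreal _ Hd); simpl; intros x y Hx Hy.
  unfold unit_disc in *.
  replace (x, y) with (z + ((x - Re z)%R, (y - Im z)%R))%C by (destruct z; C_ring).
  eapply Rle_lt_trans; [ apply Cmod_triangle | ].
  assert (Cmod ((x - Re z)%R, (y - Im z)%R) < 1 - Cmod z); [ | lra ].
  eapply Rle_lt_trans; [ apply Cmod_2Rmax | simpl ].
  assert (Rmax (Rabs (x - Re z)) (Rabs (y - Im z)) < (1 - Cmod z) / 2)
    by (now apply Rmax_lub_lt).
  assert (sqrt 2 <= 2) by (rewrite <- (sqrt_square 2) at 2 by lra; apply sqrt_le_1_alt; lra).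
  assert (0 <= Rmax (Rabs (x - Re z)) (Rabs (y - Im z)))
    by (eapply Rle_trans; [ apply Rabs_pos | apply Rmax_l ]).
  nra.
Qed.

Lemma Cn_on_disc_d_x (n : nat) (u : C -> C) :
  Cn_on_disc (S n) u -> Cn_on_disc n (d_x u).
Proof.
  intros H z Hz; destruct (H z Hz) as [[_ [_ [_ [H1 _]]]] [_ [_ [_ [H2 _]]]]].
  now split.
Qed.

Lemma Cn_on_disc_d_y (n : nat) (u : C -> C) :
  Cn_on_disc (S n) u -> Cn_on_disc n (d_y u).
Proof.
  intros H z Hz; destruct (H z Hz) as [[_ [_ [_ [_ H1]]]] [_ [_ [_ [_ H2]]]]].
  now split.
Qed.

Lemma Cn_on_disc_continuous (n : nat) (u : C -> C) (z : C) :
  Cn_on_disc n u -> unit_disc z ->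
  continuous_at (fun v => Re (u v)) z /\ continuous_at (fun v => Im (u v)) z.
Proof.
  intros H Hz; destruct (H z Hz) as [H1 H2].
  destruct n; destruct H1 as [H1 _], H2 as [H2 _]; now split.
Qed.

(** The classical criterion: the x-partial exists nearby and is continuous at the point, and the
    y-partial exists at the point. *)
Lemma has_grad_of_partials (f : C -> R) (z : C) :
  (forall v, unit_disc v -> ex_diff_n (fun x y => f (x, y)) 1 (Re v) (Im v)) ->
  unit_disc z ->
  has_grad f z (Derive (fun x => f (x, Im z)) (Re z), Derive (fun y => f (Re z, y)) (Im z)).
Proof.
  intros H Hz; apply filterdiff_differentiable_pt_lim.
  eapply filterdiff_ext_lin.
  - apply (is_derive_filterdiff (fun x y => f (x, y)) (Re z) (Im z)
             (fun x y => Derive (fun s => f (s, y)) x)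
             (Derive (fun y => f (Re z, y)) (Im z))).
    + apply (proj1 (locally_2d_locally
        (fun x y => is_derive (fun s => f (s, y)) x (Derive (fun s => f (s, y)) x)) _ _)).
      eapply locally_2d_impl; [ | apply locally_unit_disc, Hz ].
      apply locally_2d_forall; intros x y Hxy.
      apply Derive_correct, (H _ Hxy).
    + apply Derive_correct, (H _ Hz).
    + apply (continuity_2d_pt_filterlim (fun x y => Derive (fun s => f (s, y)) x)).
      apply (H _ Hz).
  - now intros [x y].
Qed.

Lemma has_grad_Cn (n : nat) (u : C -> C) (z : C) :
  Cn_on_disc (S n) u -> unit_disc z ->
  has_grad (fun v => Re (u v)) z (Re (d_x u z), Re (d_y u z)) /\
  has_grad (fun v => Im (u v)) z (Im (d_x u z), Im (d_y u z)).
Proof.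
  intros H Hz.
  assert (W : forall f x y, ex_diff_n f (S n) x y -> ex_diff_n f 1 x y).
  { intros f x y (H1 & H2 & H3 & H4 & H5); simpl.
    destruct n; destruct H4 as [H4 _], H5 as [H5 _]; tauto. }
  split.
  - apply (has_grad_of_partials (fun v => Re (u v))); [ | exact Hz ].
    intros v Hv; apply W, (H v Hv).
  - apply (has_grad_of_partials (fun v => Im (u v))); [ | exact Hz ].
    intros v Hv; apply W, (H v Hv).
Qed.

Lemma d_xy_unique (F : C -> C) (z g h : C) :
  has_grad (fun v => Re (F v)) z g -> has_grad (fun v => Im (F v)) z h ->
  d_x F z = (Re g, Re h) /\ d_y F z = (Im g, Im h).
Proof.
  intros Hg Hh; apply differentiable_pt_lim_unique in Hg, Hh.
  destruct Hg as [G1 G2], Hh as [H1 H2]; unfold d_x, d_y.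
  rewrite G1, G2, H1, H2; now split.
Qed.

Lemma mixed_partials (u : C -> C) (z : C) :
  Cn_on_disc 2 u -> unit_disc z -> d_x (d_y u) z = d_y (d_x u) z.
Proof.
  intros H Hz; unfold d_x, d_y; simpl; f_equal.
  - apply (Schwarz (fun x y => Re (u (x, y)))); [ | apply (H z Hz) .. ].
    eapply locally_2d_impl; [ | apply locally_unit_disc, Hz ].
    apply locally_2d_forall; intros x y Hxy; destruct (H _ Hxy) as [H1 _].
    simpl in H1; tauto.
  - apply (Schwarz (fun x y => Im (u (x, y)))); [ | apply (H z Hz) .. ].
    eapply locally_2d_impl; [ | apply locally_unit_disc, Hz ].
    apply locally_2d_forall; intros x y Hxy; destruct (H _ Hxy) as [_ H1].
    simpl in H1; tauto.
Qed.

(** Expanding [4 d_z d_zbar] gives [u_xx + u_yy] plus [i] times the difference of the mixed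
    partials, which cancel by Schwarz's theorem. *)
Lemma laplacian_partials (u : C -> C) (z : C) :
  Cn_on_disc 2 u -> unit_disc z ->
  laplacian u z = (d_x (d_x u) z + d_y (d_y u) z)%C.
Proof.
  intros H Hz.
  destruct (has_grad_Cn 0 (d_x u) z) as [X1 X2]; [ now apply Cn_on_disc_d_x | exact Hz | ].
  destruct (has_grad_Cn 0 (d_y u) z) as [Y1 Y2]; [ now apply Cn_on_disc_d_y | exact Hz | ].
  pose proof (mixed_partials u z H Hz) as M.
  (* The gradients of the real part [(Re u_x - Im u_y) / 2] and the imaginary part
     [(Im u_x + Re u_y) / 2] of [d_zbar u]. *)
  destruct (d_xy_unique (d_zbar u) z
    (RtoC (/ 2) * ((Re (d_x (d_x u) z), Re (d_y (d_x u) z)) +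
                    - (Im (d_x (d_y u) z), Im (d_y (d_y u) z))))%C
    (RtoC (/ 2) * ((Im (d_x (d_x u) z), Im (d_y (d_x u) z)) +
                    (Re (d_x (d_y u) z), Re (d_y (d_y u) z))))%C)
    as [E1 E2].
  - eapply has_grad_ext;
      [ | apply has_grad_scal, has_grad_plus; [ exact X1 | apply has_grad_opp, Y2 ] ].
    intros v; unfold d_zbar, Re, Im, Ci, RtoC, Cdiv, Cinv, Cmult, Cplus; simpl; field.
  - eapply has_grad_ext;
      [ | apply has_grad_scal, has_grad_plus; [ exact X2 | exact Y1 ] ].
    intros v; unfold d_zbar, Re, Im, Ci, RtoC, Cdiv, Cinv, Cmult, Cplus; simpl; field.
  - unfold laplacian, d_z; rewrite E1, E2, M.
    destruct (d_x (d_x u) z), (d_y (d_x u) z), (d_y (d_y u) z).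
    unfold Re, Im, Ci, RtoC, Cdiv, Cinv, Cmult, Cplus, Cminus, Copp, Cplus; simpl.
    f_equal; field.
Qed.

Lemma has_grad_Re_mult (c : C) (u : C -> C) (z g h : C) :
  has_grad (fun v => Re (u v)) z (Re g, Re h) -> has_grad (fun v => Im (u v)) z (Im g, Im h) ->
  has_grad (fun v => Re (c * u v)) z (Re (c * g), Re (c * h)).
Proof.
  intros H1 H2; eapply has_grad_eq.
  - eapply has_grad_ext;
      [ | apply has_grad_plus; [ apply (has_grad_scal (Re c)), H1
                               | apply (has_grad_scal (- Im c)), H2 ] ].
    intros v; simpl; unfold Re, Im; ring.
  - C_ring.
Qed.

Lemma continuous_at_Re_mult (c : C) (u : C -> C) (z : C) :
  continuous_at (fun v => Re (u v)) z -> continuous_at (fun v => Im (u v)) z ->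
  continuous_at (fun v => Re (c * u v)) z.
Proof.
  intros H1 H2.
  apply (continuity_2d_pt_minus (fun x y => Re c * Re (u (x, y)))
           (fun x y => Im c * Im (u (x, y))));
    apply continuity_2d_pt_mult; auto using continuity_2d_pt_const.
Qed.

Lemma harmonic_with_grad_component (u : C -> C) (c : C) :
  harmonic u ->
  harmonic_with_grad (fun z => Re (c * u z))
    (fun z => Re (c * d_x u z)) (fun z => Re (c * d_y u z)).
Proof.
  intros [H2 HL].
  pose proof (Cn_on_disc_d_x 1 u H2) as Hx; pose proof (Cn_on_disc_d_y 1 u H2) as Hy.
  exists (fun z => Re (c * d_x (d_x u) z)), (fun z => Re (c * d_y (d_x u) z)),
    (fun z => Re (c * d_x (d_y u) z)), (fun z => Re (c * d_y (d_y u) z)).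
  intros z Hz; split; [ | split ].
  - split; [ | split ]; apply has_grad_Re_mult; eapply has_grad_Cn; eassumption.
  - refine (conj _ (conj _ (conj _ _))); apply continuous_at_Re_mult;
      eapply (Cn_on_disc_continuous 0); try exact Hz;
      (apply Cn_on_disc_d_x || apply Cn_on_disc_d_y); assumption.
  - specialize (HL z Hz); rewrite laplacian_partials in HL by assumption.
    transitivity (Re (c * (d_x (d_x u) z + d_y (d_y u) z))); [ C_ring | ].
    rewrite HL; C_ring.
Qed.

(** Taking the direction [e] along the gradient turns the directional derivative into its norm. *)
Lemma schwarz_pick_gradient (w wx wy : C -> R) (M : R) (a : C) :
  harmonic_with_grad w wx wy -> (forall z, unit_disc z -> Rabs (w z) <= M) ->
  unit_disc a -> (1 - Cmod a ^ 2) * Cmod (wx a, wy a) <= 4 * M / PI.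
Proof.
  intros Hw HM Ha.
  destruct (Ceq_dec (wx a, wy a) 0) as [E | E].
  - rewrite E, Cmod_0, Rmult_0_r.
    pose proof PI_RGT_0.
    assert (0 <= M) by (eapply Rle_trans; [ apply Rabs_pos | apply (HM a Ha) ]).
    apply Rdiv_le_0_compat; lra.
  - pose proof (proj1 (Cmod_gt_0 _) E) as Hp.
    set (n := Cmod (wx a, wy a)) in *.
    pose proof (schwarz_pick_harmonic w wx wy M a (RtoC (/ n) * (wx a, wy a)) Hw HM Ha) as H.
    rewrite Cmod_mult, Cmod_R, Rabs_pos_eq in H
      by (apply Rlt_le, Rinv_0_lt_compat, Hp).
    fold n in H; rewrite Rinv_l in H by lra; specialize (H eq_refl).
    assert (E2 : n ^ 2 = wx a ^ 2 + wy a ^ 2) by apply Cmod2_alt.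
    rewrite re_scal_l, im_scal_l in H; simpl Re in H; simpl Im in H.
    replace (/ n * wx a * wx a + / n * wy a * wy a) with n in H; [ exact H | ].
    transitivity (/ n * n ^ 2); [ field; lra | rewrite E2; ring ].
Qed.

(** * The hyperbolic distance along geodesics *)

(** Rotation by [c = conj(d) / |d|] turns bounds on the real functions [Re (c * u)] into bounds on
    moduli. *)
Lemma exists_phase (d : C) : exists c : C, Cmod c = 1 /\ Re (c * d) = Cmod d.
Proof.
  destruct (Ceq_dec d 0) as [-> | E].
  - exists 1; rewrite Cmod_1, Cmod_0; split; [ reflexivity | ].
    unfold Re; simpl; ring.
  - pose proof (proj1 (Cmod_gt_0 _) E) as Hp.
    exists (RtoC (/ Cmod d) * Cconj d)%C; split.
    + rewrite Cmod_mult, Cmod_R, Cmod_conj, Rabs_pos_eq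
        by (apply Rlt_le, Rinv_0_lt_compat, Hp).
      apply Rinv_l; lra.
    + replace (RtoC (/ Cmod d) * Cconj d * d)%C with (RtoC (/ Cmod d) * RtoC (Cmod d ^ 2))%C
        by (rewrite Cmod2_conj; ring).
      rewrite <- RtoC_mult; simpl; field; lra.
Qed.

Lemma unit_disc_R (t : R) : 0 <= t < 1 -> unit_disc (RtoC t).
Proof. intros Ht; unfold unit_disc; rewrite Cmod_R, Rabs_pos_eq; lra. Qed.

(** So the quotient defining [rho] between [moebius a e z] and [a] is [e z], of modulus [|z|]. *)
Lemma moebius_minus (a e z : C) :
  (1 + Cconj a * e * z <> 0)%C ->
  (moebius a e z - a = e * z * (1 - Cconj a * moebius a e z))%C.
Proof. intros H; unfold moebius; field; exact H. Qed.

Lemma one_minus_conj_neq_0 (a z : C) :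
  unit_disc a -> unit_disc z -> (1 - Cconj a * z <> 0)%C.
Proof.
  intros Ha Hz.
  replace (1 - Cconj a * z)%C with (1 + - (Cconj a * z))%C by ring.
  apply unit_disc_neq_1; unfold unit_disc in *.
  rewrite Cmod_opp, Cmod_mult, Cmod_conj.
  pose proof (Cmod_ge_0 a); pose proof (Cmod_ge_0 z); nra.
Qed.

(** [rho] conjugates its first argument, whereas [moebius_minus] conjugates the base point. *)
Lemma Cmod_one_minus_conj (z w : C) : Cmod (1 - Cconj z * w) = Cmod (1 - Cconj w * z).
Proof.
  rewrite <- Cmod_conj; f_equal.
  rewrite Cminus_conj, Cmult_conj, Cconj_conj.
  replace (Cconj 1) with (RtoC 1) by C_ring; ring.
Qed.

Definition artanh (t : R) : R := / 2 * ln ((1 + t) / (1 - t)).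

Lemma artanh_pos (t : R) : 0 < t < 1 -> 0 < artanh t.
Proof.
  intros Ht; unfold artanh.
  apply Rmult_lt_0_compat; [ lra | ].
  rewrite <- ln_1; apply ln_increasing; [ lra | ].
  apply Rlt_div_r; lra.
Qed.

Lemma artanh_0 : artanh 0 = 0.
Proof.
  unfold artanh; replace ((1 + 0) / (1 - 0)) with 1 by field; rewrite ln_1; ring.
Qed.

Lemma is_derive_artanh (t : R) : -1 < t < 1 -> is_derive artanh t (/ (1 - t ^ 2)).
Proof.
  intros Ht; unfold artanh; auto_derive.
  - split; [ lra | split; [ apply Rdiv_lt_0_compat; lra | exact I ] ].
  - field; repeat split; nra.
Qed.

Lemma rho_moebius (a e : C) (t : R) :
  unit_disc a -> Cmod e = 1 -> 0 <= t < 1 -> rho (moebius a e t) a = artanh t.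
Proof.
  intros Ha He Ht; pose proof (unit_disc_R t Ht) as Hu.
  pose proof (moebius_denom a e t Ha He Hu) as Hd.
  pose proof (unit_disc_moebius a e t Ha He Hu) as Hm.
  unfold rho.
  replace (Cmod _) with t; [ reflexivity | ].
  rewrite Cmod_div by (now apply one_minus_conj_neq_0).
  rewrite Cmod_one_minus_conj, moebius_minus by exact Hd.
  rewrite !Cmod_mult, He, Cmod_R, Rabs_pos_eq by lra.
  pose proof (proj1 (Cmod_gt_0 _) (one_minus_conj_neq_0 _ _ Ha Hm)).
  field; lra.
Qed.

(** The point [k = (z - w) / (1 - conj(w) z)] is the image of [z] under the automorphism sending [w]
    to 0; its polar form gives [t = |k|] and [e = k / |k|]. *)
Lemma moebius_reach (z w : C) :
  unit_disc z -> unit_disc w -> z <> w ->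
  exists (e : C) (t : R), Cmod e = 1 /\ 0 < t < 1 /\ z = moebius w e t.
Proof.
  intros Hz Hw Hzw.
  pose proof (one_minus_conj_neq_0 w z Hw Hz) as Hd.
  pose proof (proj1 (Cmod_gt_0 _) Hd) as Hd'.
  set (k := ((z - w) / (1 - Cconj w * z))%C).
  assert (Hk : (k * (1 - Cconj w * z) = z - w)%C) by (unfold k; field; exact Hd).
  assert (Hk0 : k <> 0).
  { intros E; apply Hzw; rewrite E in Hk.
    replace z with (z - w + w)%C by ring; rewrite <- Hk; ring. }
  apply Cmod_gt_0 in Hk0 as Hkp.
  assert (Hk1 : Cmod k < 1).
  { unfold k; rewrite Cmod_div by exact Hd.
    apply Rlt_div_l; [ exact Hd' | ].
    (* The right-hand side is positive in the disc, whence [|k| < 1]. *)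
    assert (E : Cmod (1 - Cconj w * z) ^ 2 - Cmod (z - w) ^ 2 =
                (1 - Cmod w ^ 2) * (1 - Cmod z ^ 2)).
    { rewrite !Cmod2_alt.
      unfold Re, Im, Cminus, Copp, Cplus, Cmult, Cconj, RtoC; simpl; ring. }
    unfold unit_disc in *; pose proof (Cmod_ge_0 w); pose proof (Cmod_ge_0 z).
    assert (0 < (1 - Cmod w ^ 2) * (1 - Cmod z ^ 2)) by (apply Rmult_lt_0_compat; nra).
    nra. }
  exists (RtoC (/ Cmod k) * k)%C, (Cmod k).
  assert (He : Cmod (RtoC (/ Cmod k) * k) = 1).
  { rewrite Cmod_mult, Cmod_R, Rabs_pos_eq by (apply Rlt_le, Rinv_0_lt_compat, Hkp).
    apply Rinv_l; lra. }
  split; [ exact He | split; [ lra | ] ].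
  pose proof (moebius_denom w _ (Cmod k) Hw He
                (unit_disc_R _ (conj (Rlt_le _ _ Hkp) Hk1))) as Hden.
  assert (Ek : (RtoC (/ Cmod k) * k * Cmod k = k)%C).
  { transitivity (RtoC (/ Cmod k * Cmod k) * k)%C; [ rewrite RtoC_mult; ring | ].
    rewrite Rinv_l by lra; ring. }
  unfold moebius.
  replace (Cconj w * (RtoC (/ Cmod k) * k) * Cmod k)%C with (Cconj w * k)%C in *
    by (rewrite <- Ek at 1; ring).
  rewrite Ek.
  replace (k + w)%C with (z * (1 + Cconj w * k))%C.
  - field; exact Hden.
  - replace (k + w)%C with (z + k - (z - w))%C by ring; rewrite <- Hk; ring.
Qed.

Lemma is_derive_along_moebius (F : C -> R) (a e g : C) (t : R) :
  unit_disc a -> Cmod e = 1 -> 0 <= t < 1 -> has_grad F (moebius a e t) g ->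
  is_derive (fun s => F (moebius a e (RtoC s))) t (Re (g * Cconj (moebius1 a e t))).
Proof.
  intros Ha He Ht HF; pose proof (unit_disc_R t Ht) as Hu.
  pose proof (has_grad_comp_cderiv _ _ _ _ _ (has_cderiv_moebius a e t Ha He Hu) HF) as H.
  evar_last.
  - apply (has_grad_path (fun u => F (moebius a e u)) (fun s => s) (fun _ => 0) t);
      [ exact H | apply is_derive_id | apply (is_derive_const (V := R_NormedModule)) ].
  - unfold zero, one; simpl; ring.
Qed.

(* The path [t |-> moebius a e t] is a hyperbolic geodesic, parametrized with the speed of
   [artanh]. *)
Lemma Cmod_moebius1 (a e : C) (t : R) :
  unit_disc a -> Cmod e = 1 -> 0 <= t < 1 ->
  Cmod (moebius1 a e t) * (1 - t ^ 2) = 1 - Cmod (moebius a e t) ^ 2.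
Proof.
  intros Ha He Ht; pose proof (unit_disc_R t Ht) as Hu.
  pose proof (moebius_denom a e t Ha He Hu) as Hd.
  rewrite one_minus_Cmod2_moebius by assumption.
  unfold moebius1; rewrite <- Cmod2_conj, <- RtoC_minus.
  rewrite !Cmod_mult, Cmod_inv, He by exact Hd.
  pose proof (proj1 (Cmod_gt_0 _) Hd).
  unfold unit_disc in Ha; pose proof (Cmod_ge_0 a).
  rewrite !Cmod_R, !Rabs_pos_eq by nra.
  field; lra.
Qed.

(** Along the geodesic the derivative of [F] is at most [|g| |moebius1| <= K / (1 - t^2)], the
    derivative of [K * artanh t]. The mean value theorem for the difference [h] concludes. *)
Lemma hyperbolic_lipschitz (F : C -> R) (g : C -> C) (K : R) (z w : C) :
  (forall v, unit_disc v -> has_grad F v (g v)) ->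
  (forall v, unit_disc v -> (1 - Cmod v ^ 2) * Cmod (g v) <= K) ->
  unit_disc z -> unit_disc w -> z <> w -> F z - F w <= K * rho z w.
Proof.
  intros HF HK Hz Hw Hzw.
  destruct (moebius_reach z w Hz Hw Hzw) as (e & T & He & HT & ->).
  rewrite rho_moebius by (assumption || lra).
  set (h := fun t => F (moebius w e (RtoC t)) - K * artanh t).
  set (h' := fun t => Re (g (moebius w e (RtoC t)) * Cconj (moebius1 w e t)) - K * / (1 - t ^ 2)).
  destruct (MVT_cor2 h h' 0 T) as [t [E Ht]]; [ lra | | ].
  - intros t Ht; apply is_derive_Reals.
    assert (Ht' : 0 <= t < 1) by lra.
    apply (is_derive_minus (fun t => F (moebius w e (RtoC t))) (fun t => K * artanh t)).
    + apply is_derive_along_moebius; auto.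
      apply HF, unit_disc_moebius; auto using unit_disc_R.
    + apply is_derive_scal, is_derive_artanh; lra.
  - assert (Ht' : 0 <= t < 1) by lra.
    assert (h' t <= 0).
    { unfold h'.
      assert (H1 : Re (g (moebius w e t) * Cconj (moebius1 w e t)) <=
                   Cmod (g (moebius w e t)) * Cmod (moebius1 w e t)).
      { eapply Rle_trans; [ apply Rle_abs | ].
        eapply Rle_trans; [ apply re_le_Cmod | ].
        rewrite Cmod_mult, Cmod_conj; lra. }
      pose proof (HK _ (unit_disc_moebius w e t Hw He (unit_disc_R t Ht'))) as H2.
      rewrite <- Cmod_moebius1 in H2 by assumption.
      assert (Hp : 0 < 1 - t ^ 2) by nra.
      assert (Cmod (g (moebius w e t)) * Cmod (moebius1 w e t) <= K * / (1 - t ^ 2)).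
      { apply (Rle_div_r _ K (1 - t ^ 2)); [ exact Hp | lra ]. }
      lra. }
    unfold h in E; rewrite artanh_0, moebius_0 in E.
    assert (h' t * (T - 0) <= 0) by nra.
    lra.
Qed.

Lemma derive_ge_0_of_ge (h : R -> R) (d : R) :
  is_derive h 0 d -> h 0 = 0 -> (forall t, 0 < t < 1 -> 0 <= h t) -> 0 <= d.
Proof.
  intros H H0 Hh; apply Rnot_lt_le; intros Hd.
  apply is_derive_Reals in H.
  (* Tolerance [- d] forces the quotient [h t / t] to be negative for small [t]. *)
  destruct (H (- d)) as [eta He]; [ lra | ].
  pose proof (cond_pos eta) as Hp.
  set (t := Rmin (eta / 2) (/ 2)).
  assert (Ht : 0 < t <= eta / 2 /\ t <= / 2).
  { unfold t; split; [ split; [ apply Rmin_glb_lt; lra | apply Rmin_l ] | apply Rmin_r ]. }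
  assert (Hq : 0 <= h t / t) by (apply Rdiv_le_0_compat; [ apply Hh; lra | lra ]).
  specialize (He t).
  rewrite Rplus_0_l, H0, Rminus_0_r in He.
  assert (Rabs (h t / t - d) < - d) by (apply He; [ lra | rewrite Rabs_pos_eq; lra ]).
  apply Rabs_lt_between in H1; lra.
Qed.

(** Along the geodesic from [a] in direction [e], [l * artanh t] minus the increment of [F] vanishes
    at 0 and is nonnegative for [t > 0], so its derivative at 0 is nonnegative. *)
Lemma hyperbolic_derivative_le (F : C -> R) (a e g : C) (l : R) :
  unit_disc a -> Cmod e = 1 -> has_grad F a g ->
  (forall z, unit_disc z -> z <> a -> F z - F a <= l * rho z a) ->
  (1 - Cmod a ^ 2) * Re (g * Cconj e) <= l.
Proof.
  intros Ha He HF Hl.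
  assert (0 <= l * / (1 - 0 ^ 2) - Re (g * Cconj (moebius1 a e 0))).
  { apply (derive_ge_0_of_ge (fun t => l * artanh t - (F (moebius a e (RtoC t)) - F a))).
    - apply (is_derive_minus (fun t => l * artanh t) (fun t => F (moebius a e (RtoC t)) - F a)).
      + apply is_derive_scal, is_derive_artanh; lra.
      + evar_last.
        * apply (is_derive_minus (fun t => F (moebius a e (RtoC t))) (fun _ => F a)).
          -- apply is_derive_along_moebius; try eassumption; [ lra | ].
             rewrite moebius_0; eassumption.
          -- apply (is_derive_const (V := R_NormedModule)).
        * unfold minus, plus, opp, zero; simpl; ring.
    - rewrite artanh_0, moebius_0; ring.
    - intros t Ht; assert (Ht' : 0 <= t < 1) by lra.
      pose proof (unit_disc_moebius a e t Ha He (unit_disc_R t Ht')) as Hm.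
      rewrite <- (rho_moebius a e t) by assumption.
      cut (F (moebius a e t) - F a <= l * rho (moebius a e t) a); [ lra | ].
      apply Hl; [ exact Hm | ].
      (* If the geodesic returned to [a], then [rho] would be 0 there, against [artanh t > 0]. *)
      intros E.
      pose proof (rho_moebius a e t Ha He Ht') as Er.
      pose proof (artanh_pos t Ht) as Hpos.
      rewrite <- Er, E in Hpos; revert Hpos.
      unfold rho; replace (a - a)%C with (RtoC 0) by ring.
      unfold Cdiv; rewrite Cmult_0_l, Cmod_0.
      replace ((1 + 0) / (1 - 0)) with 1 by field; rewrite ln_1; lra. }
  replace (moebius1 a e 0) with (RtoC (1 - Cmod a ^ 2) * e)%C in H.
  - rewrite Cmult_conj in H.
    replace (Cconj (RtoC (1 - Cmod a ^ 2))) with (RtoC (1 - Cmod a ^ 2)) in H by C_ring.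
    replace (g * (RtoC (1 - Cmod a ^ 2) * Cconj e))%C
      with (RtoC (1 - Cmod a ^ 2) * (g * Cconj e))%C in H by ring.
    rewrite re_scal_l in H.
    replace (/ (1 - 0 ^ 2)) with 1 in H by field; lra.
  - unfold moebius1; rewrite RtoC_minus, Cmod2_conj.
    replace (1 + Cconj a * e * 0)%C with (RtoC 1) by ring; field.
Qed.

Lemma rho_pos (z w : C) : unit_disc z -> unit_disc w -> z <> w -> 0 < rho z w.
Proof.
  intros Hz Hw Hzw.
  destruct (moebius_reach z w Hz Hw Hzw) as (e & t & He & Ht & ->).
  rewrite rho_moebius by (assumption || lra); now apply artanh_pos.
Qed.

(** * Biharmonic mappings *)

(** The last term comes from the gradient [2 z] of [|z|^2]; being radial, it vanishes along
    directions orthogonal to [z]. *)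
Lemma has_grad_biharmonic (f H G : C -> C) (c z : C) :
  harmonic H -> harmonic G ->
  (forall v, unit_disc v -> f v = (H v + RtoC (Cmod v ^ 2) * G v)%C) ->
  unit_disc z ->
  has_grad (fun v => Re (c * f v)) z
    ((Re (c * d_x H z), Re (c * d_y H z)) +
     RtoC (Cmod z ^ 2) * (Re (c * d_x G z), Re (c * d_y G z)) +
     RtoC (2 * Re (c * G z)) * z)%C.
Proof.
  intros hH hG hf Hz.
  destruct (harmonic_with_grad_component H c hH) as (H11 & H12 & H21 & H22 & DH).
  destruct (harmonic_with_grad_component G c hG) as (G11 & G12 & G21 & G22 & DG).
  destruct (DH z Hz) as [[DH' _] _]; destruct (DG z Hz) as [[DG' _] _].
  apply (has_grad_ext_loc (fun v => Re (c * H v) + (Re v * Re v + Im v * Im v) * Re (c * G v))).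
  - eapply locally_2d_impl; [ | apply locally_unit_disc, Hz ].
    apply locally_2d_forall; intros x y Hxy.
    rewrite hf by exact Hxy; rewrite Cmod2_alt; C_ring.
  - eapply has_grad_eq.
    + apply has_grad_plus; [ exact DH' | ].
      apply (has_grad_mult (fun v => Re v * Re v + Im v * Im v)); [ | exact DG' ].
      apply has_grad_plus; apply has_grad_mult; apply has_grad_Re || apply has_grad_Im.
    + rewrite Cmod2_alt; destruct z; C_ring.
Qed.

Lemma Rpower_3_2 (x : R) : 0 < x -> Rpower x (3 / 2) = x * sqrt x.
Proof.
  intros Hx; replace (3 / 2) with (1 + / 2) by field.
  rewrite Rpower_plus, Rpower_1, Rpower_sqrt by assumption; reflexivity.
Qed.

(** On the left, the first term collects the Schwarz-Pick bounds for [H] and [|z|^2 G], the second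
    the radial part of the gradient. *)
Lemma biharmonic_constant (M r : R) :
  0 <= M -> 0 <= r ->
  4 * M / PI * (1 + r ^ 2) + 2 * r * M * (1 - r ^ 2) <=
  4 * M / (27 * PI ^ 3) * (8 + 36 * PI ^ 2 + Rpower (4 + 3 * PI ^ 2) (3 / 2)).
Proof.
  intros HM Hr; pose proof PI_RGT_0 as Hpi.
  rewrite Rpower_3_2 by nra.
  set (S := sqrt (4 + 3 * PI ^ 2)).
  assert (HS : S * S = 4 + 3 * PI ^ 2) by (apply sqrt_sqrt; nra).
  assert (HS1 : 1 <= S).
  { rewrite <- sqrt_1; apply sqrt_le_1_alt; nra. }
  (* The cubic on the left attains its maximum at [r = (2 + S) / (3 PI)]. *)
  apply Rminus_le_0.
  replace (_ - _) with
    (* The maximizer is a double root of the difference; the remaining linear factor is nonnegative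
       because [S >= 1]. *)
    (M / (27 * PI ^ 3) * (2 * (3 * PI * r - 2 - S) ^ 2 * (3 * PI * r + 2 * S - 2))).
  - apply Rmult_le_pos; [ apply Rdiv_le_0_compat; [ lra | pose proof (pow_lt PI 3 Hpi); lra ] | ].
    assert (0 <= PI * r) by (apply Rmult_le_pos; lra).
    apply Rmult_le_pos; [ | lra ].
    apply Rmult_le_pos; [ lra | apply pow2_ge_0 ].
  - apply Rminus_diag_uniq.
    (* The two expressions differ by a multiple of the relation [HS] defining [S]. *)
    transitivity (M / (27 * PI ^ 3) * (4 * S - 6 * (3 * PI * r - 2)) *
                  (S * S - (4 + 3 * PI ^ 2))).
    + field; lra.
    + rewrite HS; ring.
Qed.

(** If [c a = |a|], then [conj(c)] points along [a] and [i conj(c)] is a quarter turn from it. *)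
Lemma exists_orthogonal (a : C) : exists e : C, Cmod e = 1 /\ Re (a * Cconj e) = 0.
Proof.
  destruct (exists_phase a) as [c [Hc E]].
  exists (Ci * Cconj c)%C; split.
  - rewrite Cmod_mult, Cmod_Ci, Cmod_conj, Hc; ring.
  - assert (Him : Im (c * a) = 0).
    { assert (Cmod (c * a) ^ 2 = Cmod a ^ 2) as E2 by (rewrite Cmod_mult, Hc; ring).
      rewrite Cmod2_alt, E in E2; nra. }
    rewrite <- Him; C_ring.
Qed.

Lemma Cmod_diff_le_plus (A B : C) : Rabs (Cmod A - Cmod B) <= Cmod (A + B).
Proof.
  pose proof (Cmod_triangle (A + B) (- B)) as H1.
  pose proof (Cmod_triangle (A + B) (- A)) as H2.
  rewrite Cmod_opp in H1, H2.
  replace (A + B + - B)%C with A in H1 by ring.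
  replace (A + B + - A)%C with B in H2 by ring.
  apply Rabs_le; lra.
Qed.

(** * From gradient estimates to bounds on [B f] *)

Lemma quotient_in_B (f : C -> C) (z w : C) :
  unit_disc z -> unit_disc w -> z <> w -> Rbar_le (Cmod (f z - f w) / rho z w) (B f).
Proof.
  intros Hz Hw Hzw; apply (proj1 (Lub_Rbar_correct _)).
  now exists z, w.
Qed.

(** Here [d] is the derivative of [f] at [a] along [e]; the phase of [d] selects the component
    [Re (c * f)] realizing its modulus. *)
Lemma B_gradient_lower (f : C -> C) (l : R) (a e d : C) (g : C -> C) :
  B f = Finite l -> unit_disc a -> Cmod e = 1 ->
  (forall c, has_grad (fun v => Re (c * f v)) a (g c)) ->
  (forall c, Re (g c * Cconj e) = Re (c * d)) ->
  (1 - Cmod a ^ 2) * Cmod d <= l.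
Proof.
  intros Hl Ha He Hg Hd.
  destruct (exists_phase d) as [c [Hc E]].
  rewrite <- E, <- Hd.
  apply (hyperbolic_derivative_le (fun v => Re (c * f v))); auto.
  intros z Hz Hza.
  pose proof (quotient_in_B f z a Hz Ha Hza) as HB; rewrite Hl in HB; simpl in HB.
  pose proof (rho_pos z a Hz Ha Hza) as Hr.
  apply Rle_div_l in HB; [ | exact Hr ].
  eapply Rle_trans; [ | exact HB ].
  replace (Re (c * f z) - Re (c * f a)) with (Re (c * (f z - f a))) by C_ring.
  eapply Rle_trans; [ apply Rle_abs | ].
  eapply Rle_trans; [ apply re_le_Cmod | ].
  rewrite Cmod_mult, Hc; lra.
Qed.

(** For each pair of points the phase of [f z - f w] selects the component to which the hyperbolic
    Lipschitz bound applies. *)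
Lemma B_gradient_upper (f : C -> C) (K : R) (g : C -> C -> C) :
  (forall c z, Cmod c = 1 -> unit_disc z -> has_grad (fun v => Re (c * f v)) z (g c z)) ->
  (forall c z, Cmod c = 1 -> unit_disc z -> (1 - Cmod z ^ 2) * Cmod (g c z) <= K) ->
  Rbar_le (B f) K.
Proof.
  intros Hg HK; apply (proj2 (Lub_Rbar_correct _)).
  intros t (z & w & Hz & Hw & Hzw & ->).
  apply (Rle_div_l _ K); [ now apply rho_pos | ].
  destruct (exists_phase (f z - f w)) as [c [Hc <-]].
  replace (Re (c * (f z - f w))) with (Re (c * f z) - Re (c * f w)) by C_ring.
  apply (hyperbolic_lipschitz (fun v => Re (c * f v)) (g c)); auto.
Qed.

Theorem corollary3 (f H G : C -> C)
  (hf : biharmonic f)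
  (hH : harmonic H)
  (hG : harmonic G)
  (hfHG : forall z : C, unit_disc z -> f z = (H z + RtoC (Cmod z ^ 2) * G z)%C)
  (hB : Rbar_lt (B f) p_infty) :
  Rbar_le
    (Lub_Rbar (fun t : R => exists z : C, unit_disc z /\
       t = (1 - Cmod z ^ 2) *
           Rabs (Cmod (d_z H z + RtoC (Cmod z ^ 2) * d_z G z)%C
                 - Cmod (d_zbar H z + RtoC (Cmod z ^ 2) * d_zbar G z)%C)))
    (B f)
  /\
  (forall M : R, 0 < M ->
     (forall z : C, unit_disc z -> Cmod (H z) <= M /\ Cmod (G z) <= M) ->
     Rbar_le (B f)
       (Finite (4 * M / (27 * PI ^ 3) *
                (8 + 36 * PI ^ 2 + Rpower (4 + 3 * PI ^ 2) (3 / 2))))).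
Proof.
  split.
  - apply (proj2 (Lub_Rbar_correct _)).
    intros t (z & Hz & ->).
    destruct (B f) as [l | | ] eqn:El; [ | exact I | ].
    (* The supremum is not [m_infty], since the points 0 and 1/2 contribute a real quotient. *)
    2: { pose proof (quotient_in_B f 0 (RtoC (/ 2))) as Hq; rewrite El in Hq.
         apply Hq; try (apply unit_disc_R; lra).
         intros E; apply (f_equal fst) in E; simpl in E; lra. }
    destruct (exists_orthogonal z) as [e [He Hze]].
    set (A := (d_z H z + RtoC (Cmod z ^ 2) * d_z G z)%C).
    set (A' := (d_zbar H z + RtoC (Cmod z ^ 2) * d_zbar G z)%C).
    apply (Rle_trans _ ((1 - Cmod z ^ 2) * Cmod (A * e + A' * Cconj e))).
    + apply Rmult_le_compat_l.
      * unfold unit_disc in Hz; pose proof (Cmod_ge_0 z); nra.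
      (* Unimodular factors leave both moduli unchanged, so the reverse triangle inequality applies
         to the derivative along [e]. *)
      * replace (Cmod A) with (Cmod (A * e)) by (rewrite Cmod_mult, He; ring).
        replace (Cmod A') with (Cmod (A' * Cconj e)) by (rewrite Cmod_mult, Cmod_conj, He; ring).
        apply Cmod_diff_le_plus.
    + refine (B_gradient_lower f l z e _ _ El Hz He
                (fun c => has_grad_biharmonic f H G c z hH hG hfHG Hz) _).
      intros c; unfold A, A', d_z, d_zbar.
      rewrite !Cmult_plus_distr_r, re_plus.
      (* The radial term drops out because [e] is orthogonal to [z]. *)
      replace (Re (RtoC (2 * Re (c * G z)) * z * Cconj e)) with 0.
      2: { rewrite <- Cmult_assoc, re_scal_l, Hze; ring. }
      destruct (d_x H z), (d_y H z), (d_x G z), (d_y G z), e, c.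
      generalize (Cmod z ^ 2); intros s.
      unfold Re, Im, Ci, RtoC, Cdiv, Cinv, Cmult, Cplus, Cminus, Copp, Cconj; simpl; field.
  - intros M HM Hbound.
    refine (B_gradient_upper f _ _
              (fun c z Hc Hz => has_grad_biharmonic f H G c z hH hG hfHG Hz) _).
    intros c z Hc Hz.
    assert (Hre : forall d, Rabs (Re (c * d)) <= Cmod d).
    { intros d; eapply Rle_trans; [ apply re_le_Cmod | ]; rewrite Cmod_mult, Hc; lra. }
    pose proof (schwarz_pick_gradient _ _ _ M z (harmonic_with_grad_component H c hH)
      (fun v Hv => Rle_trans _ _ _ (Hre _) (proj1 (Hbound v Hv))) Hz) as BH.
    pose proof (schwarz_pick_gradient _ _ _ M z (harmonic_with_grad_component G c hG)
      (fun v Hv => Rle_trans _ _ _ (Hre _) (proj2 (Hbound v Hv))) Hz) as BG.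
    pose proof (Rle_trans _ _ _ (Hre (G z)) (proj2 (Hbound z Hz))) as BGz.
    eapply Rle_trans; [ | apply (biharmonic_constant M (Cmod z)); [ lra | apply Cmod_ge_0 ] ].
    set (gH := (Re (c * d_x H z), Re (c * d_y H z))) in *.
    set (gG := (Re (c * d_x G z), Re (c * d_y G z))) in *.
    set (r := Cmod z) in *.
    assert (Hr : 0 <= r < 1) by (split; [ apply Cmod_ge_0 | exact Hz ]).
    assert (T : Cmod (gH + RtoC (r ^ 2) * gG + RtoC (2 * Re (c * G z)) * z) <=
                Cmod gH + r ^ 2 * Cmod gG + 2 * M * r).
    { eapply Rle_trans; [ apply Cmod_triangle | ].
      apply Rplus_le_compat.
      - eapply Rle_trans; [ apply Cmod_triangle | ].
        rewrite Cmod_mult, Cmod_R, (Rabs_pos_eq (r ^ 2)) by nra; lra.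
      - rewrite Cmod_mult, Cmod_R, Rabs_mult, (Rabs_pos_eq 2) by lra.
        apply Rmult_le_compat_r; [ lra | lra ]. }
    apply (Rle_trans _ ((1 - r ^ 2) * (Cmod gH + r ^ 2 * Cmod gG + 2 * M * r))).
    + apply Rmult_le_compat_l; [ nra | exact T ].
    (* The bounds [BH] and, weighted by [r ^ 2], [BG] add up to [4 * M / PI * (1 + r ^ 2)]. *)
    + assert (r ^ 2 * ((1 - r ^ 2) * Cmod gG) <= r ^ 2 * (4 * M / PI))
        by (apply Rmult_le_compat_l; [ nra | exact BG ]).
      lra.
Qed.
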